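(* Let $k \ge 2$ be an integer and let $G$ be a graph on $n$ vertices such that $nk$ is even. If $\beta^k(G) \ge 1$, then $G$ contains a $k$-factor. Moreover, the lower bound $1$ is sharp: for every integer $k\ge 2$ and every $\varepsilon>0$ there exists a graph $G$ on $n$ vertices with $nk$ even and $1-\varepsilon < \beta^k(G) < 1$ that contains no $k$-factor.
   Context: All graphs are finite and simple. For a graph $G$, a vertex set $S\subseteq V(G)$ and a positive integer $k$, the $k$-th neighborhood $\Lambda^k_G(S)$ is the set of vertices of $G$ having at least $k$ neighbors in $S$. The $k$-th binding number is $\beta^k(G)=\min\{|\Lambda^k_G(S)|/|S| : S\subseteq V(G),\ |S|\ge k,\ \Lambda^k_G(S)\ne V(G)\}$, with the convention $\beta^k(G)=0$ if $|V(G)|<k$. A $k$-factor is a $k$-regular spanning subgraph. *)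

(* Defs.v *)
From mathcomp Require Import all_boot all_order all_algebra.

Set Implicit Arguments.
Unset Strict Implicit.
Unset Printing Implicit Defensive.

Import Order.TTheory GRing.Theory Num.Theory.
Local Open Scope ring_scope.

Definition simple_graph (T : finType) (e : rel T) : Prop :=
  symmetric e /\ irreflexive e.

Definition neighbors (T : finType) (e : rel T) (x : T) : {set T} :=
  [set y | e x y].

Definition regular (T : finType) (e : rel T) (k : nat) : Prop :=
  forall x : T, #|neighbors e x| = k.

Definition has_factor (T : finType) (e : rel T) (k : nat) : Prop :=
  exists f : rel T, [/\ simple_graph f, subrel f e & regular f k].

Definition kneighborhood (T : finType) (e : rel T) (k : nat) (S : {set T}) :
    {set T} :=
  [set x | (k <= #|neighbors e x :&: S|)%N].

Definition binding_set (T : finType) (e : rel T) (k : nat) : {set {set T}} :=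
  [set S : {set T} | (k <= #|S|)%N && (kneighborhood e k S != setT)].

Definition binding_ratio (R : realFieldType) (T : finType) (e : rel T)
    (k : nat) (S : {set T}) : R :=
  #|kneighborhood e k S|%:R / #|S|%:R.

(* Seeding the fold with an element of s makes this the true minimum of a
   nonempty s, with no artificial upper bound. *)
Definition seq_min (R : realFieldType) (s : seq R) : R :=
  \big[Num.min/head 0 s]_(x <- s) x.

Definition binding_number (R : realFieldType) (T : finType) (e : rel T)
    (k : nat) : R :=
  if (#|T| < k)%N then 0
  else seq_min [seq binding_ratio R e k A | A <- enum (binding_set e k)].

Lemma seq_min_le (R : realFieldType) (s : seq R) (x : R) :
  x \in s -> seq_min s <= x.
Proof.
rewrite /seq_min; elim: s (head 0 s) => [//|y s IHs] d.
rewrite inE big_cons ge_min => /predU1P[->|xs]; first by rewrite lexx.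
by rewrite IHs ?orbT.
Qed.

Lemma seq_min_mem (R : realFieldType) (s : seq R) :
  s != [::] -> seq_min s \in s.
Proof.
move=> s0; rewrite /seq_min big_seq.
apply: (big_ind (fun x => x \in s)) => //.
  by case: s s0 => //= a s; rewrite mem_head.
by move=> x y xs ys; case: leP.
Qed.

Lemma binding_set_neq0 (T : finType) (e : rel T) (k : nat) :
  simple_graph e -> (0 < k)%N -> (k <= #|T|)%N -> binding_set e k != set0.
Proof.
move=> [_ irr_e] k_gt0 kT.
have [S /andP[_ /eqP cardS]] : exists S : {set T}, (S \subset [set: T]) && (#|S| == k).
  have : (0 < #|[set A : {set T} | A \subset setT & #|A| == k]|)%N.
    by rewrite cards_draws cardsT bin_gt0.
  by case/card_gt0P=> A; rewrite inE; exists A.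
apply/set0Pn; exists S; rewrite inE cardS leqnn /=.
have /card_gt0P[x xS] : (0 < #|S|)%N by rewrite cardS.
apply/eqP => /setP/(_ x); rewrite !inE => h.
have : (#|neighbors e x :&: S| <= #|S :\ x|)%N.
  apply/subset_leq_card/subsetP=> y; rewrite !inE => /andP[exy ->].
  by rewrite andbT; apply: contraTneq exy => ->; rewrite irr_e.
by move/(leq_trans h); rewrite -cardS (cardsD1 x) xS add1n ltnn.
Qed.

Lemma binding_number_le (R : realFieldType) (T : finType) (e : rel T)
    (k : nat) (S : {set T}) :
  (k <= #|T|)%N -> S \in binding_set e k ->
  binding_number R e k <= binding_ratio R e k S.
Proof.
move=> kT SB; rewrite /binding_number ltnNge kT /=.
by apply/seq_min_le/map_f; rewrite mem_enum.
Qed.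

Lemma binding_number_attained (R : realFieldType) (T : finType) (e : rel T)
    (k : nat) :
  simple_graph e -> (0 < k)%N -> (k <= #|T|)%N ->
  exists2 S, S \in binding_set e k & binding_number R e k = binding_ratio R e k S.
Proof.
move=> ge k_gt0 kT; rewrite /binding_number ltnNge kT /=.
set s := [seq _ | _ <- _].
have /mapP[S] : seq_min s \in s.
  apply: seq_min_mem; rewrite -size_eq0 size_map -cardE cards_eq0.
  exact: binding_set_neq0.
by rewrite mem_enum => SB ->; exists S.
Qed.

(* Main.v *)
Require Import Defs.
From mathcomp Require Import all_boot all_order all_algebra.
From mathcomp Require Import reals zify.
From mathcomp Require boolp.

Set Implicit Arguments.
Unset Strict Implicit.
Unset Printing Implicit Defensive.

Import Order.TTheory GRing.Theory Num.Theory.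

(** If [G] has no [k]-factor and [n k] is even, Tutte's theorem yields disjoint
    sets [S], [D] such that
      [k |S| + sum_(t in D) d_(G-S)(t) + 2 <= k |D| + q],
    where [q] counts the components [C] of [G - S - D] with [k |C| + e(C, D)]
    odd.  Put into [Z] all of [D], together with one vertex [w] without
    neighbours in [D] for each odd component [C] with
    [e(C, D) = k |{u in C : d_D(u) >= k}|]; parity provides such a [w].  Since
    [k >= 2], a vertex outside [S] with [k] neighbours in [Z] already has [k]
    neighbours in [D]; counting the edges at [D] gives [|Lambda^k(Z)| < |Z|].
    If [|Z| < k], minimum degree [k] forces [q >= 2], and a [k]-set containing
    vertices of two components and most of [D] has too small a [k]-th
    neighbourhood instead.

    Tutte's [k]-factor theorem is obtained from the Tutte-Berge formula for
    matchings through a gadget, and the formula from Gallai's lemma.  Sharpness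
    is witnessed by the join of [K_s] with [s + 2] isolated vertices. *)

(** * Matchings and barriers *)

(** The points of [K] moved by [f] fall into pairs swapped by [f]; the induction deletes one pair at
    a time. *)
Lemma odd_card_fixed_points (V : finType) (f : V -> V) (K : {set V}) :
  involutive f -> {in K, forall x, f x \in K} ->
  odd #|[set x in K | f x == x]| = odd #|K|.
Proof.
move=> fK; have [n] := ubnP #|K|; elim: n K => // n IHn K ltKn closK.
have [x /andP[xK fx] | fix_K] := pickP [pred x in K | f x != x]; last first.
  congr (odd _); apply: eq_card => x; rewrite !inE.
  by have /= := fix_K x; case: (x \in K) => //= /negbFE.
have fxK : f x \in K :\ x by rewrite !inE fx closK.
have cardK := cardsD1 x K; rewrite xK (cardsD1 (f x) (K :\ x)) fxK !add1n in cardK.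
have closK' : {in K :\ x :\ f x, forall y, f y \in K :\ x :\ f x}.
  move=> y; rewrite !inE => /and3P[y_fx y_x yK]; rewrite (inj_eq (inv_inj fK)) y_x closK //.
  by rewrite andbT; apply: contra_neq y_fx => <-; rewrite fK.
rewrite cardK /= negbK -(IHn _ _ closK'); last by rewrite cardK in ltKn; apply: ltnW.
congr (odd _); apply: eq_card => y; rewrite !inE.
have [->|_] /= := eqVneq y (f x); first by rewrite fK eq_sym (negPf fx) andbF.
by have [->|_] //= := eqVneq y x; rewrite (negPf fx) andbF.
Qed.

Definition odd_labels (V L : finType) (A : {set V}) (c : V -> L) : {set L} :=
  [set l | odd #|[set x in A | c x == l]|].

(** Modulo 2, the class sizes sum to the number of odd classes. This parity later improves several
    bounds by one. *)
Lemma odd_card_odd_labels (V L : finType) (A : {set V}) (c : V -> L) :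
  odd #|odd_labels A c| = odd #|A|.
Proof.
rewrite -!sum1_card (partition_big c xpredT) //= !big_mkcond /=.
rewrite !(big_morph odd oddD (erefl _)); apply: eq_bigr => l _.
rewrite inE -sum1_card; set a := \sum_(x in _) 1.
have -> : \sum_(i in A | c i == l) 1 = a by apply: eq_bigl => x; rewrite inE.
by case: (odd a).
Qed.

Section Matching.

Variables (V : finType) (e : rel V).
Hypothesis e_sym : symmetric e.

Implicit Types (A B K : {set V}) (m n : {ffun V -> V}) (x y u v w : V).

(* A matching is encoded as an involution whose fixed points are the
   uncovered vertices. *)
Definition matching A m :=
  [forall x, (m (m x) == x) && ((m x != x) ==> (x \in A) && e x (m x))].

Definition exposed A m := [set x in A | m x == x].

Definition maximum_matching A m :=
  matching A m &&
  [forall m' : {ffun V -> V}, matching A m' ==> (#|exposed A m| <= #|exposed A m'|)].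

Lemma matchingP A m :
  reflect (involutive m /\ forall x, m x != x -> x \in A /\ e x (m x)) (matching A m).
Proof.
apply: (iffP forallP) => [H | [mK H] x].
  split=> [x | x mx]; first by case/andP: (H x) => /eqP.
  by case/andP: (H x) => _ /implyP/(_ mx)/andP.
by rewrite mK eqxx; apply/implyP=> /H[-> ->].
Qed.

Lemma matching_closed A m : matching A m -> {in A, forall x, m x \in A}.
Proof.
move=> /matchingP[mK H] x xA; have [->//|mx] := eqVneq (m x) x.
by apply: (H (m x) _).1; rewrite mK eq_sym.
Qed.

Lemma maximum_matchingP A m :
  reflect (matching A m /\ forall m', matching A m' -> #|exposed A m| <= #|exposed A m'|)
          (maximum_matching A m).
Proof.
apply: (iffP andP) => [[? /forallP H] | [? H]]; split=> //.
  by move=> m' mm'; apply: (implyP (H m')).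
by apply/forallP=> m'; apply/implyP/H.
Qed.

Lemma maximum_matching_exists A : exists m, maximum_matching A m.
Proof.
have m0 : matching A [ffun x => x].
  by apply/matchingP; split=> [x | x]; rewrite !ffunE ?eqxx.
case: (arg_minnP (fun m => #|exposed A m|) m0) => m mm min_m.
by exists m; apply/maximum_matchingP.
Qed.

Definition switch (K : {set V}) (m n : {ffun V -> V}) : {ffun V -> V} :=
  [ffun x => if x \in K then n x else m x].

Lemma switch_matching A K m n :
    (forall x, (m x \in K) = (x \in K)) -> (forall x, (n x \in K) = (x \in K)) ->
  matching A m -> matching A n -> matching A (switch K m n).
Proof.
move=> Km Kn /matchingP[mK mA] /matchingP[nK nA]; apply/matchingP; split=> x; rewrite !ffunE.
  by have [xK|xK] := boolP (x \in K); rewrite ?Kn ?Km ?xK ?(negPf xK) ?nK ?mK.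
by case: ifP => _; [apply: nA | apply: mA].
Qed.

Lemma card_exposed_switch A K m n :
  #|exposed A (switch K m n)| = #|exposed A n :&: K| + #|exposed A m :\: K|.
Proof.
rewrite -(cardsID K (exposed A (switch K m n))); congr (_ + _); apply: eq_card => x.
  by rewrite !inE ffunE; case: (x \in K); rewrite ?andbF ?andbT.
by rewrite !inE ffunE; case: (x \in K).
Qed.

(* The orbit of [w] under [m \o n] is the component of [w] in the union of the
   two matchings.  It is a path starting at [w], so it contains at most one
   vertex missed by [m]: [m u = u] at [u = p^i w] forces [p^(2i) w = p w]. *)
Lemma alternating_path_end m n w u v :
    involutive m -> involutive n -> n w = w -> m u = u -> m v = v ->
  fconnect (m \o n) w u -> fconnect (m \o n) w v -> u = v.
Proof.
move=> mK nK nw mu mv; set p := m \o n.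
(* Conjugation by [n] inverts [p], and [n] fixes [w], so [n] sends [p^i w] to [p^(-i) w]. *)
have back i : iter i p (n (iter i p w)) = w.
  elim: i => // i IHi; rewrite iterSr iterS.
  by rewrite -[RHS]IHi /p /= nK mK.
have twice x i : m x = x -> iter i p w = x -> iter (i + i) p w = p w.
  move=> mx ix; rewrite iterD ix -{1}mx -{1}(nK x) -/(p (n x)) -iterSr iterS.
  by rewrite -[in LHS]ix back.
have power i j : iter (i + i) p w = p w -> iter (j * (i + i)) p w = iter j p w.
  by move=> ii; elim: j => //= j IHj; rewrite mulSn addnC iterD ii -iterSr iterS IHj.
move=> /iter_findex iu /iter_findex iv.
(* With [u = p^i w] and [v = p^j w], both [u] and [v] turn out to be [p^(2ij) w]. *)
have vE := power _ (findex p w v) (twice _ _ mu iu); rewrite iv in vE.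
have uE := power _ (findex p w u) (twice _ _ mv iv); rewrite iu in uE.
by rewrite -[LHS]uE -[RHS]vE !mulnDr (mulnC (findex p w u)).
Qed.

(** Since [n] fixes [w] and inverts [p = m \o n], it reverses the orbit of [w]; and [m] is
    [p \o n]. *)
Lemma orbit_closed m n w :
    involutive m -> involutive n -> n w = w ->
  let K := [set x | fconnect (m \o n) w x] in
  (forall x, (m x \in K) = (x \in K)) /\ (forall x, (n x \in K) = (x \in K)).
Proof.
move=> mK nK nw; set p := m \o n.
have p_inj : injective p by apply: inj_comp; apply: inv_inj.
have Kp x : fconnect p w (p x) = fconnect p w x.
  by apply/esym/same_connect_r; [apply: fconnect_sym | apply: fconnect1].
have nKx x : fconnect p w x -> fconnect p w (n x).
  move/iter_findex=> <-; elim: (findex _ _ _) => [|i IHi] /=; first by rewrite nw.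
  by rewrite -Kp /p /= nK mK.
have nE x : fconnect p w (n x) = fconnect p w x.
  by apply/idP/idP => /nKx; rewrite ?nK.
split=> x; rewrite !inE; last exact: nE.
have -> : m x = p (n x) by rewrite /p /= nK.
by rewrite Kp nE.
Qed.

Definition coexposed A u v :=
  [exists m, [&& maximum_matching A m, u \in exposed A m & v \in exposed A m]].

Lemma coexposedC A u v : coexposed A u v = coexposed A v u.
Proof. by apply: eq_existsb => m; congr (_ && _); rewrite andbC. Qed.

(* Gallai's lemma. *)
Lemma coexposed_trans A u v w :
    u != v -> coexposed A w w ->
  ~~ coexposed A u w -> ~~ coexposed A w v -> ~~ coexposed A u v.
Proof.
move=> neq_uv /existsP[n /and3P[/maximum_matchingP[mn maxn] wn _]] Huw Hwv.
apply/negP=> /existsP[m /and3P[/maximum_matchingP[mm maxm] um vm]].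
have [mK _] := matchingP _ _ mm; have [nK _] := matchingP _ _ mn.
have nw : n w = w by move: wn; rewrite inE => /andP[_ /eqP].
have := orbit_closed mK nK nw; set K := [set x | _] => /= -[Km Kn].
(* The two switched matchings together miss as many vertices as [m] and [n] do, and [switch K n m]
   misses no fewer than [n]; so [switch K m n] misses no more than [m]. *)
have maxs : maximum_matching A (switch K m n).
  apply/maximum_matchingP; split=> [|m' mm']; first exact: switch_matching.
  apply: leq_trans (maxm _ mm').
  have := maxn _ (switch_matching Kn Km mn mm).
  by rewrite !card_exposed_switch -(cardsID K (exposed A n)) -(cardsID K (exposed A m)); lia.
(* Otherwise [switch K m n] would miss both [x] and [w]. Hence [u] and [v] both lie on the
   alternating path from [w], which has room for only one of them. *)
have inK x : x \in exposed A m -> ~~ coexposed A x w -> x \in K.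
  move=> xm; apply: contraR => xK; apply/existsP; exists (switch K m n); rewrite maxs /=.
  move: xm wn; rewrite !inE !ffunE (negPf xK) => -> /andP[-> _] /=.
  by rewrite inE connect0 nw eqxx.
have uK := inK u um Huw; have vK : v \in K by apply: (inK v vm); rewrite coexposedC.
move: um vm uK vK; rewrite !inE => /andP[_ /eqP mu] /andP[_ /eqP mv] uK vK.
by rewrite (alternating_path_end mK nK nw mu mv uK vK) eqxx in neq_uv.
Qed.

(** A matching that misses both ends of an edge can be enlarged by that edge. *)
Lemma coexposed_adjacent A u v :
  u \in A -> v \in A -> u != v -> e u v -> ~~ coexposed A u v.
Proof.
move=> uA vA neq_uv euv; apply/negP=> /existsP[m /and3P[/maximum_matchingP[mm maxm]]].
rewrite !inE uA vA /= => /eqP mu /eqP mv; have [mK mA] := matchingP _ _ mm.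
pose m' := [ffun x => if x == u then v else if x == v then u else m x].
have mneq x y : m y = y -> x != y -> m x != y.
  by move=> my; apply: contra_neq => mx; apply: (can_inj mK); rewrite mx my.
have mm' : matching A m'.
  apply/matchingP; split=> x; rewrite !ffunE.
    have [->|xu] := eqVneq x u; first by rewrite eqxx eq_sym (negPf neq_uv).
    have [->|xv] := eqVneq x v; first by rewrite eqxx.
    by rewrite (negPf (mneq _ _ mu xu)) (negPf (mneq _ _ mv xv)) mK.
  have [->|xu] := eqVneq x u; first by [].
  by have [->|xv] := eqVneq x v; [rewrite e_sym | apply: mA].
have := maxm _ mm'; apply/negP; rewrite -ltnNge; apply: proper_card; apply/properP; split.
  apply/subsetP=> x; rewrite !inE ffunE => /andP[-> /=].
  have [->|xu] := eqVneq x u; first by rewrite eq_sym (negPf neq_uv).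
  by have [->|//] := eqVneq x v; rewrite (negPf neq_uv).
by exists u; rewrite !inE ?uA ?mu ?eqxx // ffunE eqxx eq_sym (negPf neq_uv) andbF.
Qed.

Lemma odd_card_exposed A m : matching A m -> odd #|exposed A m| = odd #|A|.
Proof.
by move=> mm; apply: odd_card_fixed_points; [case/matchingP: mm | apply: matching_closed].
Qed.

(* The Tutte-Berge formula.  A labelling that is constant along the edges of
   [A :\: B] replaces its connected components; merging components never
   increases the number of odd ones. *)
Lemma Tutte_Berge A :
  exists m B (c : V -> {set V}),
    [/\ matching A m, B \subset A,
        {in A :\: B &, forall x y, e x y -> c x = c y} &
        #|exposed A m| + #|B| <= #|odd_labels (A :\: B) c|].
Proof.
have [n] := ubnP #|A|; elim: n A => // n IHn A ltAn.
(* If every maximum matching covers [v], then [v] joins the barrier obtained for [A :\ v]. *)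
have [/exists_inP[v vA Nv] | ] := boolP [exists v in A, ~~ coexposed A v v].
  have cardA := cardsD1 v A; rewrite vA add1n in cardA.
  have [|m' [B [c [mm' BA cE le_odd]]]] := IHn (A :\ v); first by lia.
  have [m /maximum_matchingP[mm maxm]] := maximum_matching_exists A.
  have [/matchingP[mK' mA']] := mm'.
  have mv' : m' v = v by apply/eqP/negP=> /negP /mA'; rewrite !inE eqxx => -[].
  have mm'A : matching A m'.
    by apply/matchingP; split=> // x /mA'; rewrite inE => -[/andP[_ ->]].
  have AB : A :\: (v |: B) = (A :\ v) :\: B by rewrite setDDl.
  have cardB : #|v |: B| = #|B|.+1.
    rewrite cardsU1; move/subsetP: BA => /(_ v).
    by rewrite !inE eqxx /=; case: (v \in B) => // /(_ isT).
  have cardm' : #|exposed A m'| = #|exposed (A :\ v) m'|.+1.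
    rewrite (cardsD1 v) !inE vA mv' eqxx add1n; congr _.+1; apply: eq_card => x.
    by rewrite !inE andbA.
  exists m, (v |: B), c; rewrite AB; split=> //.
    by rewrite subUset sub1set vA (subset_trans BA) // subD1set.
  (* As [m'] misses [v], it is not maximum in [A]; by parity [m] misses at least two vertices fewer,
     which pays for adding [v] to the barrier. *)
  rewrite cardB; have := maxm _ mm'A; rewrite leq_eqVlt => /predU1P[eq_m|].
    case/negP: Nv; apply/existsP; exists m'; rewrite !inE vA mv' eqxx !andbT.
    by apply/maximum_matchingP; split=> // m'' /maxm; rewrite eq_m.
  have := odd_card_exposed mm; rewrite -(odd_card_exposed mm'A) cardm'.
  by move=> odd_m lt_m; lia.
rewrite negb_exists_in => /forall_inP Hco; have {}Hco v : v \in A -> coexposed A v v.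
  by move=> vA; have := Hco v vA; rewrite negbK.
have [m maxm] := maximum_matching_exists A; have [mm _] := maximum_matchingP _ _ maxm.
have [mK mA] := matchingP _ _ mm.
(* Now every vertex is missed by some maximum matching, so Gallai's lemma makes [sim] an equivalence
   on [A]. Its classes serve as labels, with an empty barrier. *)
pose sim u v := (u == v) || ~~ coexposed A u v.
have simC u v : sim u v = sim v u by rewrite /sim eq_sym coexposedC.
have sim_trans w u v : w \in A -> sim u w -> sim w v -> sim u v.
  move=> wA; rewrite /sim; have [->//|_] /= := eqVneq u w.
  have [->|_] /= := eqVneq w v; first by move=> ->; rewrite orbT.
  have [//|neq_uv] /= := eqVneq u v; exact: coexposed_trans (Hco w wA).
pose c x := [set y in A | sim x y].
have sim_c u v : u \in A -> v \in A -> sim u v -> c u = c v.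
  move=> uA vA uv; apply/setP=> x; rewrite !inE; case: (x \in A) => //=.
  by apply/idP/idP; [apply: (sim_trans u) => //; rewrite simC | apply: (sim_trans v)].
have c_sim u v : v \in A -> c u = c v -> sim u v.
  by move=> vA /setP/(_ v); rewrite !inE vA {2}/sim eqxx.
exists m, set0, c; split=> //; first exact: sub0set.
  move=> x y; rewrite setD0 => xA yA exy; apply: sim_c => //; rewrite /sim.
  by have [//|] /= := eqVneq x y; move/coexposed_adjacent; apply.
rewrite cards0 addn0 setD0.
(* Vertices missed by [m] lie in distinct classes. Matched vertices are adjacent, hence equivalent,
   so [m] pairs up the rest of each such class, which is therefore odd. *)
rewrite -(card_in_imset (f := c)); last first.
  move=> x y xm ym /c_sim; have yA : y \in A by move: ym; rewrite inE => /andP[].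
  rewrite /sim; have [//|_] /= := eqVneq x y; move/(_ yA)/negP; case.
  by apply/existsP; exists m; rewrite maxm xm.
apply/subset_leq_card/subsetP=> _ /imsetP[x xm ->].
have xA : x \in A by move: xm; rewrite inE => /andP[].
rewrite inE -(odd_card_fixed_points mK) => [|y]; last first.
  rewrite !inE => /andP[yA /eqP <-]; rewrite (matching_closed mm) //=; apply/eqP/esym.
  have [->//|my] := eqVneq (m y) y; apply: sim_c => //; first exact: matching_closed.
  rewrite /sim coexposed_adjacent ?orbT //; first exact: matching_closed.
    by rewrite eq_sym.
  by case: (mA y my).
set F := [set y in _ | m y == y]; suff -> : F = [set x] by rewrite cards1.
apply/setP=> y.
rewrite !inE; apply/andP/eqP => [[/andP[yA /eqP cyx] /eqP my] | ->]; last first.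
  by rewrite xA eqxx; move: xm; rewrite inE => /andP[].
move/(c_sim _ _ xA): cyx; rewrite /sim; have [//|_] /= := eqVneq y x.
by case/negP; apply/existsP; exists m; rewrite maxm xm andbT inE yA my eqxx.
Qed.

(* If [x] sees at most two labels, moving it from the barrier into the merged
   class loses at most one odd class. *)
Lemma odd_labels_merge (L : finType) (A B : {set V}) (c : V -> L) x (l1 l2 : L) :
    x \in B -> B \subset A ->
    {in A :\: B &, forall y z, e y z -> c y = c z} ->
    {in A :\: B, forall y, e x y -> (c y == l1) || (c y == l2)} ->
  exists c' : V -> L,
    {in A :\: (B :\ x) &, forall y z, e y z -> c' y = c' z} /\
    #|odd_labels (A :\: B) c| <= #|odd_labels (A :\: (B :\ x)) c'| + 1.
Proof.
move=> xB BA cE cx.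
have xA := subsetP BA x xB.
have ABx : A :\: (B :\ x) = x |: (A :\: B).
  by apply/setP=> y; rewrite !inE; have [->|] //= := eqVneq y x; rewrite xA.
have xAB : x \notin A :\: B by rewrite !inE xB.
pose c' y := if (y == x) || (c y == l2) then l1 else c y.
have c'x : {in A :\: B, forall y, e x y -> c' y = c' x}.
  move=> y yAB exy; rewrite /c' eqxx /=; case: ifP => // /negbT; rewrite negb_or => /andP[_ cy].
  by have := cx y yAB exy; rewrite (negPf cy) orbF => /eqP.
exists c'; rewrite ABx; split.
  move=> y z /setU1P[->|yAB] /setU1P[->|zAB] // eyz; first by rewrite c'x.
    by rewrite c'x // e_sym.
  rewrite /c'; have yx : y != x by apply: contraNneq xAB => <-.
  have zx : z != x by apply: contraNneq xAB => <-.
  by rewrite (negPf yx) (negPf zx) (cE y z).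
(* Only the classes of [l1] and [l2] are affected, so at most two odd labels are lost; the two
   counts have opposite parity, so at most one is. *)
have odd_c := odd_card_odd_labels (A :\: B) c.
have odd_c' := odd_card_odd_labels (x |: (A :\: B)) c'.
rewrite cardsU1 xAB oddD -odd_c in odd_c'.
suff : #|odd_labels (A :\: B) c| <= #|odd_labels (x |: (A :\: B)) c'| + 2 by lia.
rewrite addnC.
apply: leq_trans (_ : #|[set l1; l2] :|: odd_labels (x |: (A :\: B)) c'| <= _); last first.
  by apply: leq_trans (leq_card_setU _ _) _; rewrite leq_add2r cards2; case: (l1 != l2).
apply/subset_leq_card/subsetP=> l; rewrite !inE.
have [->//|l_l1] := eqVneq l l1; have [->//|l_l2] /= := eqVneq l l2.
congr (odd _); apply: eq_card => y; rewrite !inE /c'.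
have [->|_] /= := eqVneq y x; first by rewrite xB [l1 == l]eq_sym (negPf l_l1).
by have [->|//] := eqVneq (c y) l2; rewrite ![_ == l]eq_sym (negPf l_l2) (negPf l_l1).
Qed.

(* The barrier is taken minimal, so that every vertex of it sees three labels. *)
Lemma Tutte_barrier A :
    ~~ odd #|A| -> ~ (exists m, matching A m /\ exposed A m = set0) ->
  exists B (c : V -> {set V}),
    [/\ B \subset A, {in A :\: B &, forall x y, e x y -> c x = c y},
        #|B| + 2 <= #|odd_labels (A :\: B) c| &
        forall x l1 l2, x \in B ->
          exists y, [/\ y \in A :\: B, e x y, c y != l1 & c y != l2]].
Proof.
move=> evenA no_pm.
pose barrier (b : nat) := exists B (c : V -> {set V}),
  [/\ B \subset A, {in A :\: B &, forall x y, e x y -> c x = c y},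
      #|B| + 2 <= #|odd_labels (A :\: B) c| & #|B| = b].
have [b bP] : exists b, barrier b.
  have [m [B [c [mm BA cE le_odd]]]] := Tutte_Berge A.
  (* Tutte-Berge gives a surplus of at least one odd label over [#|B|]; as [#|A|] is even, the
     surplus is even, hence at least two. *)
  exists #|B|, B, c; split=> //; have := odd_card_odd_labels (A :\: B) c.
  have : #|exposed A m| != 0 by rewrite cards_eq0; apply/eqP => m0; apply: no_pm; exists m.
  have := cardsID B A; rewrite (setIidPr BA); lia.
elim/ltn_ind: b bP => b IHb [B [c [BA cE le_odd cardB]]].
have [/exists_inP[x xB] | ] := boolP [exists x in B, exists l1, exists l2,
    [forall y in [set y in A :\: B | e x y], (c y == l1) || (c y == l2)]].
  case/existsP=> l1 /existsP[l2 /forall_inP H].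
  have [|c' [cE' le']] := @odd_labels_merge _ A B c x l1 l2 xB BA cE.
    by move=> y yAB exy; apply: H; rewrite inE yAB.
  have cardB' := cardsD1 x B; rewrite xB add1n in cardB'.
  apply: (IHb #|B :\ x|); first by lia.
  exists (B :\ x), c'; split=> //; last by lia.
  by rewrite (subset_trans _ BA) // subD1set.
rewrite negb_exists_in => /forall_inP H; exists B, c; split=> // x l1 l2 xB.
have := H x xB; rewrite negb_exists => /forallP/(_ l1); rewrite negb_exists => /forallP/(_ l2).
rewrite negb_forall_in => /exists_inP[y].
rewrite inE negb_or => /andP[yAB exy] /andP[? ?].
by exists y.
Qed.

End Matching.

(** * Factors *)

Lemma sum_card_const (T : finType) (k : nat) (S : {set T}) :
  \sum_v #|[set i : 'I_k | v \in S]| = k * #|S|.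
Proof.
rewrite mulnC -sum_nat_const [RHS]big_mkcond; apply: eq_bigr => v _.
case: (v \in S); last by rewrite -(cards0 'I_k); apply: eq_card => i; rewrite !inE.
by rewrite -[RHS]card_ord; apply: eq_card => i; rewrite inE.
Qed.

Lemma sum_card_cond (T T' : finType) (D : {set T}) (Q : T -> pred T') :
  \sum_v #|[set w | (v \in D) && Q v w]| = \sum_(v in D) #|[set w | Q v w]|.
Proof.
rewrite [RHS]big_mkcond; apply: eq_bigr => v _; case: (v \in D) => //.
by rewrite -(cards0 T'); apply: eq_card => w; rewrite !inE.
Qed.

Section Gadget.

Variables (T : finType) (e : rel T) (k : nat).
Hypothesis e_simple : simple_graph e.

Let e_sym : symmetric e := e_simple.1.
Let e_irr : irreflexive e := e_simple.2.

(* Tutte's gadget: each vertex [v] becomes [k] copies [inl (v, i)], and each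
   edge [vw] becomes two adjacent ports [inr (v, w)] and [inr (w, v)], the port
   [inr (v, w)] being joined to all copies of [v].  The pairs [inr (v, w)] with
   [~~ e v w] are junk, excluded by [gadget_set]. *)
Definition gadget : finType := ((T * 'I_k) + (T * T))%type.

Definition gadget_adj (x y : gadget) :=
  match x, y with
  | inl (v, _), inr (v', _) => v == v'
  | inr (v, _), inl (v', _) => v == v'
  | inr (v, w), inr (v', w') => (v == w') && (w == v')
  | _, _ => false
  end.

Definition gadget_set : {set gadget} :=
  [set x : gadget | if x is inr (v, w) then e v w else true].

Lemma gadget_adj_sym : symmetric gadget_adj.
Proof.
by move=> [[v i]|[v w]] [[v' i']|[v' w']] //=; rewrite ![v' == _]eq_sym // [w' == _]eq_sym andbC.
Qed.

Lemma card_gadget (P : pred gadget) :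
  #|[set x | P x]| =
  \sum_v #|[set i | P (inl (v, i))]| + \sum_v #|[set w | P (inr (v, w))]|.
Proof.
rewrite -sum1_card big_mkcond big_sumType /=; congr (_ + _).
  under [RHS]eq_bigr do rewrite -sum1_card big_mkcond.
  by rewrite pair_bigA; apply: eq_bigr => -[v i] _; rewrite !inE.
under [RHS]eq_bigr do rewrite -sum1_card big_mkcond.
by rewrite pair_bigA; apply: eq_bigr => -[v i] _; rewrite !inE.
Qed.

(** Reversal is an involution without fixed points on ordered adjacent pairs. *)
Lemma even_sum_degrees : ~~ odd (\sum_v #|neighbors e v|).
Proof.
have swapK : involutive (fun p : T * T => (p.2, p.1)) by case.
have := @odd_card_fixed_points _ _ [set p : T * T | e p.1 p.2] swapK.
have -> : #|[set p : T * T | e p.1 p.2]| = \sum_v #|neighbors e v|.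
  rewrite -sum1_card big_mkcond.
  under [RHS]eq_bigr do rewrite -sum1_card big_mkcond.
  by rewrite pair_bigA; apply: eq_bigr => -[v w] _; rewrite !inE.
move=> <- => [|[v w]]; last by rewrite !inE e_sym.
rewrite (_ : [set p in _ | _] = set0) ?cards0 //; apply/setP=> -[v w]; rewrite !inE /=.
by apply/negP=> /andP[evw /eqP[wv _]]; rewrite wv e_irr in evw.
Qed.

Lemma even_card_gadget_set : ~~ odd (#|T| * k) -> ~~ odd #|gadget_set|.
Proof.
move=> evenT; rewrite card_gadget oddD negb_add.
have -> : \sum_(v : T) #|[set i : 'I_k | true]| = #|T| * k.
  rewrite mulnC -cardsT -sum_card_const; apply: eq_bigr => v _.
  by apply: eq_card => i; rewrite !inE.
by rewrite (negPf evenT) eq_sym; have /negPf -> := even_sum_degrees.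
Qed.

(** The factor keeps the edges whose two ports are not matched to each other. Such ports are matched
    to copies, and the [k] copies of [v] use exactly [k] ports of [v]. *)
Lemma factor_of_gadget_matching m :
  matching gadget_adj gadget_set m -> exposed gadget_set m = set0 -> has_factor e k.
Proof.
move=> mm /setP m0; have [mK mA] := matchingP _ _ _ mm.
have mneq x : x \in gadget_set -> m x != x.
  by move=> xA; have := m0 x; rewrite inE xA /= inE => ->.
have adj x : x \in gadget_set -> gadget_adj x (m x).
  by move=> xA; have [] := mA x (mneq x xA).
have mset x : x \in gadget_set -> m x \in gadget_set by apply: (matching_closed mm).
pose f v w := e v w && (m (inr (v, w)) != inr (w, v)).
exists f; split=> [|v w /andP[]//|v].
  split=> [v w|v]; last by rewrite /f e_irr.
  rewrite /f e_sym; congr (_ && ~~ _).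
  by apply/eqP/eqP => h; apply: (can_inj mK); rewrite mK h.
pose g i := if m (inl (v, i)) is inr (_, w) then w else v.
have gE i : m (inl (v, i)) = inr (v, g i).
  have := adj (inl (v, i)); rewrite inE /g => /(_ isT).
  by case: (m _) => [[? ?]//|[v' w]] /eqP ->.
have g_inj : injective g.
  move=> i j gij; have : m (inl (v, i)) = m (inl (v, j)) by rewrite !gE gij.
  by move/(can_inj mK) => -[].
rewrite -[RHS]card_ord -(card_codom g_inj); apply: eq_card => w.
rewrite !inE /f; apply/idP/codomP => [/andP[evw mvw] | [i ->]].
  have := adj (inr (v, w)); rewrite inE => /(_ evw) /=.
  case mE: (m (inr (v, w))) => [[v' i]|[v' w']].
    by move/eqP=> vv'; exists i; have := gE i; rewrite vv' -mE mK => -[_ <-].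
  by case/andP=> /eqP vw' /eqP wv'; rewrite mE vw' wv' eqxx in mvw.
have := mset (inl (v, i)); rewrite gE !inE => /(_ isT) -> /=.
by rewrite -gE mK.
Qed.

End Gadget.

(* Belck's and Tutte's k-factor theorem, with labels in place of components. *)
Theorem factor_barrier (T : finType) (e : rel T) (k : nat) :
    simple_graph e -> 0 < k -> ~~ odd (#|T| * k) -> ~ has_factor e k ->
  exists (L : finType) (S D : {set T}) (c : T -> L),
    let P l := [set u in ~: (S :|: D) | c u == l] in
    [/\ [disjoint S & D],
        {in ~: (S :|: D) &, forall u v, e u v -> c u = c v} &
        k * #|S| + \sum_(t in D) #|neighbors e t :\: S| + 2 <=
        k * #|D| + #|[set l | odd (k * #|P l| + \sum_(u in P l) #|neighbors e u :&: D|)]|].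
Proof.
move=> e_simple k_gt0 evenT no_factor; have [e_sym e_irr] := e_simple.
have [|B [c [BA cE le_odd B_min]]] :=
    Tutte_barrier (@gadget_adj_sym T k) (even_card_gadget_set e_simple evenT).
  by case=> m [mm m0]; apply: no_factor; apply: factor_of_gadget_matching mm m0.
pose i0 : 'I_k := Ordinal k_gt0; set A := gadget_set e k in BA cE le_odd B_min.
have copyA v i : inl (v, i) \in A by rewrite inE.
have portA v w : (inr (v, w) \in A) = e v w by rewrite inE.
pose S := [set v | inl (v, i0) \in B].
pose D := [set v | (v \notin S) && [forall w, e v w ==> (inr (v, w) \in B)]].
(* If one copy of [v] were in [B] and another outside, all ports of [v] outside [B] would carry the
   label of the latter, so the former would see one label only, against [B_min]. *)
have copyB v i : (inl (v, i) \in B) = (v \in S).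
  suff sub i1 i2 : inl (v, i1) \in B -> inl (v, i2) \in B by rewrite inE; apply/idP/idP; apply: sub.
  move=> v1; apply: contraLR (v1) => v2; apply/negP => _.
  have [[[? ?]|[v' w]] [//]] := B_min _ (c (inl (v, i2))) (c (inl (v, i2))) v1.
  move=> yAB /= vv' /eqP[]; apply: cE => //=; first by rewrite in_setD v2 copyA.
  by rewrite eq_sym.
(* A port of [v] in [B] sees three labels, only one of which can come from the opposite port; so two
   copies of [v] outside [B] have different labels. A port of [v] outside [B] would join them, so
   there is none. *)
have portB v w : (inr (v, w) \in B) = (v \in D) && e v w.
  apply/idP/andP => [vwB | [vD evw]]; last first.
    by move: vD; rewrite [v \in D]inE => /andP[_ /forallP/(_ w)]; rewrite evw.
  have evw : e v w by rewrite -portA (subsetP BA).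
  split=> //; have [y []] := B_min _ (c (inl (v, i0))) (c (inr (w, v))) vwB.
  case: y => [[v' i]|[w' v']] yAB /=; last first.
    by case/andP=> /eqP <- /eqP <-; rewrite eqxx.
  move=> /eqP vv' ne_c _; rewrite -{v'}vv' in yAB ne_c.
  have vS : v \notin S by move: yAB; rewrite in_setD copyB => /andP[].
  rewrite inE vS; apply/forallP=> w'; apply/implyP=> evw'.
  apply: contraR ne_c => vw'B; apply/eqP.
  have vw'AB : inr (v, w') \in A :\: B by rewrite in_setD vw'B portA.
  rewrite (cE _ _ yAB vw'AB) /= ?eqxx //; apply: cE => //=.
  by rewrite in_setD copyB vS copyA.
have SD : [disjoint S & D].
  by rewrite disjoint_sym disjoints_subset; apply/subsetP=> v; rewrite !inE => /andP[].
pose U := ~: (S :|: D).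
have UP u : (u \in U) = (u \notin S) && (u \notin D) by rewrite in_setC in_setU negb_or.
pose cU u := c (inl (u, i0)).
have portAB u w : u \in U -> e u w -> inr (u, w) \in A :\: B.
  by rewrite UP in_setD portB portA => /andP[_ /negPf->] ->.
have copyAB u i : u \in U -> inl (u, i) \in A :\: B.
  by rewrite UP in_setD copyB copyA => /andP[-> _].
have c_port u w : u \in U -> e u w -> c (inr (u, w)) = cU u.
  by move=> uU euw; apply: cE; rewrite ?portAB ?copyAB //=.
have c_copy u i : u \in U -> c (inl (u, i)) = cU u.
  move=> uU; have [w euw] : exists w, e u w.
    move: (uU); rewrite UP => /andP[uS]; rewrite inE uS /= negb_forall => /existsP[w].
    by rewrite negb_imply => /andP[]; exists w.
  by rewrite -(c_port u w) //; apply: cE; rewrite ?portAB ?copyAB //=.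
clearbody A D S; exists {set gadget T k}, S, D, cU => P; split=> //.
  move=> u v uU vU euv; rewrite -(c_port u v) // -(c_port v u) ?(e_sym v) //.
  by apply: cE; rewrite ?portAB ?(e_sym v) //= !eqxx.
set q := #|[set l | _]|.
have cardB : #|B| = k * #|S| + \sum_(t in D) #|neighbors e t|.
  have -> : B = [set x : gadget T k | match x with inl (v, _) => v \in S
                                      | inr (v, w) => (v \in D) && e v w end].
    by apply/setP=> -[[v i]|[v w]]; rewrite inE ?copyB ?portB.
  rewrite card_gadget sum_card_const sum_card_cond; congr (_ + _).
(* Vertices of these two kinds have all their neighbours in [B]. They contribute at most one odd
   label each; every other odd label comes from an odd class of [U]. *)
pose copiesD := [set x : gadget T k | if x is inl (t, _) then t \in D else false].
pose portsSD := [set x : gadget T k |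
  if x is inr (s, t) then [&& s \in S, t \in D & e s t] else false].
have card_copiesD : #|copiesD| = k * #|D|.
  rewrite card_gadget [X in _ + X]big1 ?addn0 => [|v _]; last first.
    by apply/eqP; rewrite cards_eq0; apply/eqP/setP=> w; rewrite !inE.
  by rewrite sum_card_const.
have card_portsSD : #|portsSD| = \sum_(t in D) #|neighbors e t :&: S|.
  rewrite card_gadget [X in X + _]big1 ?add0n => [|v _]; last first.
    by apply/eqP; rewrite cards_eq0; apply/eqP/setP=> w; rewrite !inE.
  under eq_bigr do rewrite -sum1_card big_mkcond.
  rewrite exchange_big [RHS]big_mkcond; apply: eq_bigr => t _.
  case tD: (t \in D); last by rewrite big1 // => s _; rewrite inE tD andbF.
  rewrite -sum1_card [RHS]big_mkcond; apply: eq_bigr => s _.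
  by rewrite !inE tD /= (e_sym s) andbC.
have sub_odd : odd_labels (A :\: B) c \subset
    (c @: copiesD :|: c @: portsSD) :|:
    [set l | odd (k * #|P l| + \sum_(u in P l) #|neighbors e u :&: D|)].
  apply/subsetP=> l l_odd; rewrite in_setU; case: (boolP (l \in _ :|: _)) => //= lSD.
  move: lSD; rewrite in_setU negb_or => /andP[lD lS].
  have lDn t i : t \in D -> c (inl (t, i)) != l.
    by move=> tD; apply: contraNneq lD => <-; apply: imset_f; rewrite inE.
  have lSn s t : s \in S -> t \in D -> e s t -> c (inr (s, t)) != l.
    by move=> sS tD est; apply: contraNneq lS => <-; apply: imset_f; rewrite inE sS tD.
  rewrite inE; move: l_odd; rewrite inE.
  (* Opposite ports carry the same label, so they cancel out modulo 2. *)
  pose flip (x : gadget T k) : gadget T k := match x with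
    | inr (v, w) => if (v \in D) || (w \in D) then x else inr (w, v)
    | _ => x end.
  have flipK : involutive flip.
    move=> [[v i]|[v w]] //=; case: ifP => /= [->//|vwD]; by rewrite orbC vwD.
  rewrite -(odd_card_fixed_points flipK) => [|[[v i]|[v w]]] //; last first.
    rewrite /flip; case: ifP => // /norP[vD wD].
    rewrite !inE !portB !portA (negPf vD) (negPf wD) /=.
    move=> /andP[evw /eqP <-]; rewrite e_sym evw; apply/eqP/cE; rewrite /= ?eqxx //.
      by rewrite in_setD portB (negPf wD) portA e_sym.
    by rewrite in_setD portB (negPf vD) portA.
  congr (is_true (odd _)).
  (* The fixed points of [flip] with label [l] are the [k] copies of each [u] in [P l] and the ports
     from [P l] to [D]. *)
  pose F := [set x : gadget T k | match x with inl (u, _) => u \in P l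
               | inr (u, t) => (u \in P l) && (t \in neighbors e u :&: D) end].
  have -> : [set x in [set x in A :\: B | c x == l] | flip x == x] = F.
    have PE u : (u \in P l) = (u \in U) && (cU u == l) by rewrite in_set.
    apply/setP=> -[[v i]|[v w]]; rewrite [LHS]in_set [in LHS]in_set in_setD [RHS]in_set PE UP.
      rewrite copyB copyA eqxx !andbT; case: (boolP (v \in S)) => //= vS.
      case: (boolP (v \in D)) => //= vD; first by rewrite (negPf (lDn _ _ vD)).
      by rewrite c_copy // UP vS.
    rewrite portB portA in_setI [w \in neighbors _ _]in_set /flip.
    case: (boolP (e v w)) => /= evw; last by rewrite !andbF.
    case: (boolP (v \in D)) => /= vD; first by rewrite !andbF.
    case: (boolP (w \in D)) => /= wD.
      rewrite eqxx !andbT; case: (boolP (v \in S)) => /= vS; first exact/negbTE/lSn.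
      by rewrite c_port // UP vS.
    rewrite !andbF; apply/negP=> /andP[_ /eqP[wv _]].
    by rewrite wv e_irr in evw.
  rewrite card_gadget sum_card_const sum_card_cond; congr (_ + _).
  by apply: eq_bigr => u _; apply: eq_card => w; rewrite inE.
have le_q : #|odd_labels (A :\: B) c| <= k * #|D| + \sum_(t in D) #|neighbors e t :&: S| + q.
  apply: leq_trans (subset_leq_card sub_odd) _; apply: leq_trans (leq_card_setU _ _) _.
  rewrite leq_add2r; apply: leq_trans (leq_card_setU _ _) _.
  by rewrite -card_copiesD -card_portsSD leq_add // leq_imset_card.
have split_deg : \sum_(t in D) #|neighbors e t| =
    \sum_(t in D) #|neighbors e t :&: S| + \sum_(t in D) #|neighbors e t :\: S|.
  by rewrite -big_split; apply: eq_bigr => t _ /=; rewrite cardsID.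
by move: le_odd; rewrite cardB split_deg; lia.
Qed.

(** * Expansion *)

Lemma binding_number_ge1_expand (R : realFieldType) (T : finType) (e : rel T) (k : nat) :
    0 < k -> (1 <= binding_number R e k)%R ->
  k <= #|T| /\ forall Z : {set T}, k <= #|Z| -> #|Z| <= #|kneighborhood e k Z|.
Proof.
move=> k_gt0 b1; have kT : k <= #|T|.
  by move: b1; rewrite /binding_number; case: ltnP => //; rewrite ler10.
(* Sets with full [k]-th neighbourhood do not enter the minimum, but satisfy the inequality
   trivially. *)
split=> // Z kZ; have [->|ZT] := eqVneq (kneighborhood e k Z) setT.
  by rewrite cardsT max_card.
have Zb : Z \in binding_set e k by rewrite inE kZ.
have := le_trans b1 (binding_number_le R kT Zb); rewrite /binding_ratio.
by rewrite ler_pdivlMr ?mul1r ?ler_nat // ltr0n; lia.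
Qed.

Lemma exists_superset_card (T : finType) (A : {set T}) n :
  #|A| <= n <= #|T| -> exists2 B : {set T}, A \subset B & #|B| = n.
Proof.
elim: n => [|n IHn] /andP[leA len].
  by exists A => //; apply/eqP; rewrite -leqn0.
move: leA; rewrite leq_eqVlt => /predU1P[<-|ltA]; first by exists A.
have [|B AB cardB] := IHn; first by lia.
have /card_gt0P[x xB] : 0 < #|~: B| by have := cardsC B; lia.
exists (x |: B); first by rewrite (subset_trans AB) // subsetUr.
by rewrite cardsU1; move: xB; rewrite inE => ->; rewrite cardB.
Qed.

Lemma exists_subset_card (T : finType) (A : {set T}) n :
  n <= #|A| -> exists2 B : {set T}, B \subset A & #|B| = n.
Proof.
move=> leA; have : 0 < #|[set B : {set T} | B \subset A & #|B| == n]|.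
  by rewrite cards_draws bin_gt0.
by case/card_gt0P=> B; rewrite inE => /andP[BA /eqP]; exists B.
Qed.

Section Expansion.

Variables (T : finType) (e : rel T) (k : nat).
Hypothesis e_simple : simple_graph e.
Hypothesis k_ge2 : 2 <= k.
Hypothesis k_leT : k <= #|T|.
Hypothesis expand : forall Z : {set T}, k <= #|Z| -> #|Z| <= #|kneighborhood e k Z|.

Let e_sym : symmetric e := e_simple.1.
Let e_irr : irreflexive e := e_simple.2.

(** Expansion of the whole vertex set forces its [k]-th neighbourhood to be everything. *)
Lemma min_degree v : k <= #|neighbors e v|.
Proof.
have := expand (Z := setT); rewrite cardsT => /(_ k_leT) le_T.
have : v \in kneighborhood e k setT.
  suff -> : kneighborhood e k setT = setT by [].
  by apply/eqP; rewrite eqEcard subsetT cardsT.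
by rewrite inE setIT.
Qed.

Lemma sum_card_neighbors (X Y : {set T}) :
  \sum_(x in X) #|neighbors e x :&: Y| = \sum_(y in Y) #|neighbors e y :&: X|.
Proof.
have E (A B : {set T}) :
    \sum_(x in A) #|neighbors e x :&: B| = \sum_(x in A) \sum_(y in B) e x y.
  apply: eq_bigr => x _; rewrite -sum1_card [LHS]big_mkcond [RHS]big_mkcond.
  by apply: eq_bigr => y _; rewrite !inE; case: (y \in B); rewrite ?andbF ?andbT //; case: e.
rewrite !E exchange_big; apply: eq_bigr => y _; apply: eq_bigr => x _.
by rewrite e_sym.
Qed.

Variables (L : finType) (S D : {set T}) (c : T -> L).
Hypothesis SD : [disjoint S & D].
Let U := ~: (S :|: D).
Hypothesis c_edge : {in U &, forall u v, e u v -> c u = c v}.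
Let P l := [set u in U | c u == l].
Let dD v := #|neighbors e v :&: D|.
Let O := [set l | odd (k * #|P l| + \sum_(u in P l) dD u)].
Let Bl l := [set u in P l | k <= dD u].
(* The odd classes whose edges to [D] all end in [Bl l], [k] at each vertex. *)
Let X := [set l in O | \sum_(u in P l) dD u <= k * #|Bl l|].

Let sum_Bl l : k * #|Bl l| <= \sum_(u in P l) dD u.
Proof.
rewrite mulnC -sum_nat_const big_mkcond [leqRHS]big_mkcond.
apply: leq_sum => u _; rewrite [u \in Bl l]inE; case: (u \in P l) => //=.
by case: ifP.
Qed.

(** The vertices of [Bl l] alone already exhaust the sum allowed by [X]. *)
Let X_tight l u : l \in X -> u \in P l -> dD u < k -> dD u = 0.
Proof.
rewrite inE => /andP[_ le_X] uP ltk.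
have : k * #|Bl l| + dD u <= \sum_(v in P l) dD v.
  rewrite (bigD1 u) //= addnC leq_add2l mulnC -sum_nat_const big_mkcond [leqRHS]big_mkcond.
  apply: leq_sum => v _; rewrite [v \in Bl l]inE; case: (v \in P l) => //=.
  by case: ifP => // kv; have [vu|//] := eqVneq v u; rewrite vu leqNgt ltk in kv.
by lia.
Qed.

(** If all of [P l] had [k] neighbours in [D], tightness would make the quantity defining [O] equal
    to [2 k |P l|], which is even. *)
Let X_rep l : l \in X -> exists2 w, w \in P l & dD w = 0.
Proof.
move=> lX; have [w /andP[wP wk] | all_k] := pickP [pred w in P l | dD w < k].
  by exists w => //; apply: X_tight lX wP wk.
have PB : P l = Bl l.
  apply/setP=> u; rewrite [RHS]inE; have /= := all_k u; case: (u \in P l) => //=.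
  by move/negbT; rewrite -leqNgt => ->.
have := sum_Bl l; move: lX; rewrite inE PB => /andP[]; rewrite inE PB => odd_l le1 le2.
have E : \sum_(u in Bl l) dD u = k * #|Bl l| by apply/eqP; rewrite eqn_leq le1 le2.
by rewrite E addnn odd_double in odd_l.
Qed.

Lemma barrier_bound :
  k * #|S| + \sum_(t in D) #|neighbors e t :\: S| + 2 <= k * #|D| + #|O| -> False.
Proof.
move=> barrier.
pose B := [set v in ~: S | k <= dD v].
have DU v : (v \in ~: S) = (v \in D) || (v \in U).
  rewrite !inE negb_or; case: (boolP (v \in D)) => /= [vD|_]; last by rewrite andbT.
  by apply/negP=> vS; have := disjointFr SD vS; rewrite vD.
have UP v l : (v \in P l) = (v \in U) && (c v == l) by rewrite inE.
have split_sum (F : T -> nat) :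
    \sum_(v in ~: S) F v = \sum_(t in D) F t + \sum_l \sum_(u in P l) F u.
  have -> : \sum_l \sum_(u in P l) F u = \sum_(u in U) F u.
    rewrite [RHS](partition_big c xpredT) //=; apply: eq_bigr => l _.
    by apply: eq_bigl => u; rewrite UP.
  rewrite (bigID (mem D)); congr (_ + _); apply: eq_bigl => v; rewrite DU /=.
    by case: (v \in D); rewrite ?andbT ?andbF.
  by rewrite /U in_setC in_setU; case: (v \in D); rewrite ?orbT ?andbT ?andbF.
have card_cond (A : {set T}) (p : pred T) : #|[set v in A | p v]| = \sum_(v in A) p v.
  rewrite -sum1_card big_mkcond [RHS]big_mkcond; apply: eq_bigr => v _.
  by rewrite inE; case: (v \in A); case: (p v).
(* The edges from [D] to the complement of [S] are counted at their ends outside [S]: each vertex of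
   [B] receives at least [k], and each class in [O] but not in [X] receives at least one more than
   [k |Bl l|]. *)
have ltSB : k * (#|S| + #|B|) + 2 <= k * #|D| + #|X|.
  have sumS : \sum_(t in D) #|neighbors e t :\: S| =
      \sum_(t in D) dD t + \sum_l \sum_(u in P l) dD u.
    by under eq_bigr do rewrite setDE; rewrite sum_card_neighbors split_sum.
  have cardB : #|B| = \sum_(t in D) (k <= dD t) + \sum_l #|Bl l|.
    by rewrite card_cond split_sum; congr (_ + _); apply: eq_bigr => l _; rewrite card_cond.
  have le_D : k * (\sum_(t in D) (k <= dD t)) <= \sum_(t in D) dD t.
    by rewrite big_distrr /=; apply: leq_sum => t _; case: (leqP k (dD t)); rewrite ?muln1 ?muln0.
  have le_L : k * (\sum_l #|Bl l|) + #|O| <= \sum_l \sum_(u in P l) dD u + #|X|.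
    rewrite -!sum1_card (big_mkcond (mem O)) (big_mkcond (mem X)) big_distrr /= -!big_split /=.
    apply: leq_sum => l _; rewrite [l \in X]inE; case: (l \in O) => /=; last first.
      by rewrite !addn0 sum_Bl.
    by case: (leqP (\sum_(u in P l) dD u) _); rewrite ?leq_add2r ?addn0 ?addn1 // sum_Bl.
  by lia.
have [w wP] : exists w : L -> T, forall l, l \in X -> w l \in P l /\ dD (w l) = 0.
  apply: (@fin_all_exists L (fun _ => T) (fun l x => l \in X -> x \in P l /\ dD x = 0)) => l.
  have [lX|_] := boolP (l \in X); first by have [x] := X_rep lX; exists x.
  by have /card_gt0P[x _] : 0 < #|T|; [lia | exists x].
pose W := w @: X; pose Z := D :|: W.
have cardZ : #|Z| = #|D| + #|X|.
  rewrite cardsU (_ : D :&: W = set0) ?cards0 ?subn0.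
    congr (_ + _); apply: card_in_imset => l1 l2 /wP[l1P _] /wP[l2P _] eq_w.
    by move: l1P l2P; rewrite !UP eq_w => /andP[_ /eqP <-] /andP[_ /eqP].
  apply/setP=> v; rewrite !inE; apply/negP=> /andP[vD /imsetP[l /wP[lP _] v_w]].
  by move: lP; rewrite UP -v_w !inE vD orbT.
(* A vertex outside [S] with fewer than [k] neighbours in [D] must see some representative, so it is
   not in [D] and lies in a class of [X]. Then it has no neighbour in [D] and sees only the
   representative of its own class, which is too few for [k >= 2]. *)
have subZ : kneighborhood e k Z \subset S :|: B.
  apply/subsetP=> v; rewrite inE => kv; rewrite in_setU [v \in B]inE in_setC.
  case: (boolP (v \in S)) => //= vS; rewrite leqNgt; apply/negP=> ltk.
  have := leq_trans kv (_ : _ <= dD v + #|neighbors e v :&: W|).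
  rewrite setIUr => /(_ (leq_card_setU _ _)) le_k.
  have [x] : exists x, x \in neighbors e v :&: W by apply/card_gt0P; lia.
  rewrite !inE => /andP[evx /imsetP[l lX x_w]]; have [xP dDx] := wP l lX.
  have := DU v; rewrite in_setC vS => /esym/orP[vD | vU].
    by move/cards0_eq/setP: dDx => /(_ v); rewrite !inE vD andbT -x_w e_sym evx.
  have [xU cx] : x \in U /\ c x = l by move: xP; rewrite UP -x_w => /andP[? /eqP].
  have cv : c v = l by rewrite -cx; apply: c_edge.
  have dDv : dD v = 0 by apply: (X_tight lX) => //; rewrite UP vU cv eqxx.
  have : #|neighbors e v :&: W| <= 1.
    rewrite -(cards1 x); apply/subset_leq_card/subsetP=> y; rewrite !inE.
    case/andP=> evy /imsetP[l' /wP[yP _] y_w]; move: yP; rewrite UP -y_w => /andP[yU /eqP cy].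
    by rewrite y_w x_w -cy -cv (c_edge vU yU evy).
  by lia.
have leSB : #|kneighborhood e k Z| <= #|S| + #|B|.
  exact: leq_trans (subset_leq_card subZ) (leq_card_setU _ _).
have ltZ : #|S| + #|B| < #|Z|.
  rewrite -(ltn_pmul2l (m := k)) ?cardZ ?mulnDr; last by lia.
  have : #|X| <= k * #|X| by rewrite leq_pmull //; lia.
  by move: ltSB; rewrite mulnDr; lia.
have [kZ|Zk] := leqP k #|Z|; first by have := expand kZ; lia.
(* Here [|D| < k], and each vertex of [D] has at least [k - |S|] neighbours outside [S]; inserting
   this into [barrier] leaves [2 <= |O|]. *)
have O2 : 1 < #|O|.
  have : \sum_(t in D) (k - #|S|) <= \sum_(t in D) #|neighbors e t :\: S|.
    apply: leq_sum => t _; have := min_degree t; rewrite -(cardsID S).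
    have := subset_leq_card (subsetIr (neighbors e t) S); lia.
  rewrite sum_nat_const mulnBr; have : #|D| * #|S| <= k * #|S| by rewrite leq_mul2r; lia.
  by move: barrier; rewrite (mulnC k #|D|); lia.
have O_nonempty l : l \in O -> exists u, u \in P l.
  rewrite inE => odd_l; apply/set0Pn; apply: contraL odd_l => /eqP ->.
  by rewrite cards0 muln0 big_set0.
have /card_gt1P[l1 [l2 [/O_nonempty[u1 u1P] /O_nonempty[u2 u2P] l12]]] := O2.
(* The size [k - 2] leaves room for [u1] and [u2] in a [k]-set. A vertex with [k] neighbours in a
   [k]-set sees all of it, and no vertex of [U] sees two classes. *)
have [D' D'D cardD'] := exists_subset_card (geq_minl #|D| (k - 2)).
have [|Z1 subZ1 cardZ1] := @exists_superset_card _ ([set u1; u2] :|: D') k.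
  rewrite k_leT andbT; apply: leq_trans (leq_card_setU _ _) _; rewrite cards2 cardD'.
  by case: (u1 != u2); lia.
have subS : kneighborhood e k Z1 \subset S :|: (D :\: D').
  apply/subsetP=> v; rewrite inE => kv.
  have Z1v : Z1 \subset neighbors e v.
    by apply/setIidPr/eqP; rewrite eqEcard subsetIr cardZ1.
  have adj x : x \in [set u1; u2] :|: D' -> e v x.
    by move=> xZ; have := subsetP Z1v x (subsetP subZ1 x xZ); rewrite inE.
  have [vU|] := boolP (v \in U).
    case/eqP: l12; move: u1P u2P; rewrite !UP => /andP[u1U /eqP <-] /andP[u2U /eqP <-].
    rewrite -(c_edge vU u1U) ?(c_edge vU u2U) //; apply: adj; rewrite !inE eqxx ?orbT //.
  rewrite inE negbK !inE => /orP[-> //|vD]; rewrite vD andbT.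
  have [vD'|] := boolP (v \in D'); rewrite ?orbT //.
  by have := adj v; rewrite !inE vD' !orbT e_irr => /(_ isT).
(* From [|Z| < k], [ltZ] gives [|S| <= k - 2], and [D :\: D'] has at most one element; together
   fewer than [k]. *)
have := expand (Z := Z1); rewrite cardZ1 leqnn => /(_ isT).
have := leq_trans (subset_leq_card subS) (leq_card_setU _ _).
rewrite cardsD (setIidPr D'D) cardD'; lia.
Qed.

End Expansion.

Lemma factor_of_expansion (T : finType) (e : rel T) (k : nat) :
    simple_graph e -> 2 <= k -> ~~ odd (#|T| * k) -> k <= #|T| ->
    (forall Z : {set T}, k <= #|Z| -> #|Z| <= #|kneighborhood e k Z|) ->
  has_factor e k.
Proof.
move=> e_simple k_ge2 evenT k_leT expand; apply: boolp.contrapT => no_factor.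
have [L [S [D [c [SD c_edge]]]]] := factor_barrier e_simple (ltnW k_ge2) evenT no_factor.
exact: barrier_bound.
Qed.

(** * Sharpness *)

Section CompleteSplitGraph.

Variable s : nat.

Definition split_vertex : finType := ('I_s + 'I_(s + 2))%type.

Definition split_edge (x y : split_vertex) :=
  match x, y with
  | inl a, inl b => a != b
  | inr _, inr _ => false
  | _, _ => true
  end.

Definition split_clique : {set split_vertex} := [set x | if x is inl _ then true else false].

Lemma split_simple : simple_graph split_edge.
Proof.
split=> [[a|a] [b|b] //|[a|a] //] /=; first by rewrite eq_sym.
by rewrite eqxx.
Qed.

Lemma card_split_clique : #|split_clique| = s.
Proof.
rewrite -[RHS]card_ord -(card_imset _ (@inl_inj 'I_s 'I_(s + 2))).
by apply: eq_card => -[a|b]; rewrite !inE; apply/esym/imsetP; [exists a | case].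
Qed.

Lemma card_split_vertex : #|split_vertex| = (s + 1).*2.
Proof. by rewrite card_sum !card_ord; lia. Qed.

Lemma card_split_independent : #|~: split_clique| = s + 2.
Proof. by have := cardsC split_clique; rewrite card_split_clique card_split_vertex; lia. Qed.

Lemma split_neighbors_independent x :
  x \notin split_clique -> neighbors split_edge x = split_clique.
Proof. by case: x => [a|b]; rewrite inE // => _; apply/setP=> -[a|b']; rewrite !inE. Qed.

Lemma split_neighbors_clique x : x \in split_clique -> neighbors split_edge x = ~: [set x].
Proof.
case: x => [a|b]; rewrite inE // => _; apply/setP=> -[a'|b]; rewrite !inE //=.
by rewrite eq_sym.
Qed.

(** The independent side would send [(s + 2) k] factor edges into a clique able to receive only
    [s k]. *)
Lemma split_no_factor k : 0 < k -> ~ has_factor split_edge k.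
Proof.
move=> k_gt0 [f [f_simple f_sub f_reg]].
have := sum_card_neighbors f_simple (~: split_clique) split_clique.
have -> : \sum_(x in ~: split_clique) #|neighbors f x :&: split_clique| = (s + 2) * k.
  rewrite -card_split_independent -sum_nat_const; apply: eq_bigr => x.
  rewrite in_setC => xI; rewrite -[RHS](f_reg x); congr #|pred_of_set _|; apply/setIidPl.
  by rewrite -(split_neighbors_independent xI); apply/subsetP=> y; rewrite !inE; apply: f_sub.
have : \sum_(y in split_clique) #|neighbors f y :&: ~: split_clique| <= \sum_(y in split_clique) k.
  by apply: leq_sum => y _; rewrite -(f_reg y) subset_leq_card // subsetIl.
by rewrite sum_nat_const card_split_clique; nia.
Qed.

(** No independent vertex has a neighbour on its own side. The resulting ratio, at most
    [s / (s + 2)], puts the binding number below 1. *)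
Lemma split_binding_independent k :
  0 < k <= s -> ~: split_clique \in binding_set split_edge k /\
  #|kneighborhood split_edge k (~: split_clique)| <= s.
Proof.
case/andP=> k_gt0 k_s.
have sub : kneighborhood split_edge k (~: split_clique) \subset split_clique.
  apply/subsetP=> x; rewrite [x \in kneighborhood _ _ _]inE; apply: contraLR => xI.
  by rewrite split_neighbors_independent // setICr cards0 -ltnNge.
have := subset_leq_card sub; rewrite card_split_clique => le_s; split=> //.
rewrite inE card_split_independent; apply/andP; split; first by lia.
by apply: contraTneq le_s => ->; rewrite cardsT card_split_vertex; lia.
Qed.

(** If [|Z| = k], the clique vertices outside [Z] see all of [Z], and there are at least
    [s - k >= k] of them. If [|Z| > k], every clique vertex has [k] neighbours in [Z]; a vertex that
    does not is independent, so [Z] has at most [k - 1] clique vertices besides at most [s + 2]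
    others. *)
Lemma split_binding_bound k (Z : {set split_vertex}) :
    k.*2 <= s -> Z \in binding_set split_edge k ->
  #|Z| <= #|kneighborhood split_edge k Z| \/
  s <= #|kneighborhood split_edge k Z| /\ #|Z| <= s + k + 1.
Proof.
move=> k_s; rewrite inE => /andP[kZ ZT].
have cliqueE x : x \in split_clique -> (x \in kneighborhood split_edge k Z) = (k <= #|Z :\ x|).
  by move=> xC; rewrite inE split_neighbors_clique // setIC -setDE.
move: kZ; rewrite leq_eqVlt => /predU1P[cardZ|kZ]; [left | right].
  apply: leq_trans (_ : #|split_clique :\: Z| <= _).
    have := cardsID Z split_clique; rewrite card_split_clique.
    have := subset_leq_card (subsetIr split_clique Z); lia.
  apply/subset_leq_card/subsetP=> x; rewrite in_setD => /andP[xZ xC].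
  by rewrite cliqueE // cardZ (cardsD1 x Z) (negPf xZ).
have subC : split_clique \subset kneighborhood split_edge k Z.
  by apply/subsetP=> x xC; rewrite cliqueE //; have := cardsD1 x Z; case: (x \in Z); lia.
split; first by have := subset_leq_card subC; rewrite card_split_clique.
have [y yZ] : exists y, y \notin kneighborhood split_edge k Z.
  apply/existsP; rewrite -negb_forall; apply: contra ZT => /forallP H.
  by apply/eqP/setP=> x; rewrite H inE.
have yC : y \notin split_clique by apply: contra yZ; apply: (subsetP subC).
move: yZ; rewrite inE split_neighbors_independent // -ltnNge.
have := cardsID split_clique Z; rewrite setIC.
have := subset_leq_card (subsetIr Z (~: split_clique)); rewrite -setDE card_split_independent.
by lia.
Qed.

End CompleteSplitGraph.

Local Open Scope ring_scope.

Lemma binding_sharp (R : realType) (k : nat) (eps : R) : (0 < k)%N -> 0 < eps ->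
  exists (T : finType) (e : rel T),
    [/\ simple_graph e, ~~ odd (#|T| * k),
        1 - eps < binding_number R e k < 1 & ~ has_factor e k].
Proof.
(* The summand [k.*2] serves [split_binding_bound]; [N] ensures [k + 1 < eps * s], whence
   [s / (s + k + 1) > 1 - eps]. *)
move=> k_gt0 eps_gt0; pose N := Num.bound (k.+1%:R / eps : R); pose s := (k.*2 + N)%N.
exists (split_vertex s), (@split_edge s); split.
- exact: split_simple.
- by rewrite card_split_vertex; lia.
- have k_T : (k <= #|split_vertex s|)%N by rewrite card_split_vertex /s; lia.
  apply/andP; split; last first.
    have [|Zb le_s] := @split_binding_independent s k; first by rewrite /s; lia.
    apply: le_lt_trans (binding_number_le R k_T Zb) _; rewrite /binding_ratio.
    by rewrite ltr_pdivrMr ?mul1r ?ltr_nat ?ltr0n card_split_independent; lia.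
  have [Z Zb ->] := binding_number_attained R (split_simple s) k_gt0 k_T.
  have Z_gt0 : 0 < #|Z|%:R :> R by move: Zb; rewrite ltr0n inE => /andP[]; lia.
  rewrite /binding_ratio ltr_pdivlMr // mulrBl mul1r ltrBlDr.
  have [le_Z|lt_Z] := leqP #|Z| #|kneighborhood (@split_edge s) k Z|.
    apply: (@le_lt_trans _ _ #|kneighborhood (@split_edge s) k Z|%:R); first by rewrite ler_nat.
    by rewrite ltrDl mulr_gt0.
  have [|le_Z|[le_s le_Z]] := split_binding_bound _ Zb; first by rewrite /s; lia.
    by lia.
  have lt_N : k.+1%:R < eps * N%:R.
    by rewrite mulrC -ltr_pdivrMr // archi_boundP // divr_ge0 // ltW.
  apply: le_lt_trans (_ : _ <= (#|kneighborhood (@split_edge s) k Z| + k.+1)%:R) _.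
    by rewrite ler_nat; lia.
  rewrite natrD ltrD2l; apply: lt_le_trans lt_N _.
  rewrite ler_pM2l // ler_nat (leq_trans _ (ltnW lt_Z)) // (leq_trans _ le_s) //.
  exact: leq_addl.
- exact: split_no_factor.
Qed.

Theorem theorem1p1 (R : realType) (k : nat) (hk : (2 <= k)%N) :
  (forall (T : finType) (e : rel T),
     simple_graph e -> ~~ odd (#|T| * k) ->
     1 <= binding_number R e k -> has_factor e k) /\
  (forall eps : R, 0 < eps ->
     exists (T : finType) (e : rel T),
       [/\ simple_graph e, ~~ odd (#|T| * k),
           1 - eps < binding_number R e k < 1 & ~ has_factor e k]).
Proof.
split=> [T e e_simple evenT b1 | eps]; last by apply: binding_sharp; apply: ltnW.
have [k_T expand] := binding_number_ge1_expand (ltnW hk) b1.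
exact: factor_of_expansion.
Qed.
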